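(* Let $\mathcal{E}$ be a locally cartesian closed category with a strict initial object. Then $(\mathsf{dense},\mathsf{closed})$, i.e. the pair of the class of dense morphisms (left class) and the class of closed morphisms (right class), is an orthogonal factorization system on $\mathcal{E}$.
   Context: A category $\mathcal{E}$ with pullbacks is locally cartesian closed if for every morphism $p\colon E\to B$ the pullback functor $\Delta_p\colon\mathcal{E}/B\to\mathcal{E}/E$ has a right adjoint $\Pi_p\colon\mathcal{E}/E\to\mathcal{E}/B$. An initial object $\mathbf{0}$ is strict if every morphism into it is invertible. Negation: for $p\colon E\to B$, the negation $\neg p\colon B\setminus\mathrm{im}\,p\to B$ is $\neg p:=\Pi_p(\mathbf{0}\to E)$, an object of $\mathcal{E}/B$. Write $\neg\neg p:=\neg(\neg p)$. A morphism $f\colon A\to B$ is closed if $\neg\neg f\cong f$ in $\mathcal{E}/B$, and dense if $\neg\neg f\cong \mathrm{id}_B$ in $\mathcal{E}/B$. An orthogonal factorization system on $\mathcal{E}$ consists of two classes of morphisms $\mathscr{L},\mathscr{R}$ such that: (i) every morphism $f$ decomposes as $f=r\cdot l$ with $r\in\mathscr{R}$, $l\in\mathscr{L}$; (ii) given any other such decomposition $f=r'\cdot l'$ with $r'\in\mathscr{R}$, $l'\in\mathscr{L}$, there is a unique isomorphism $\alpha$ with $\alpha l=l'$ and $r'\alpha=r$; (iii) $\mathscr{L}$ and $\mathscr{R}$ are closed under composition and contain all isomorphisms. *)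

(* Defs.v *)
From Corelib Require Import ssreflect.
From Stdlib Require Import ProofIrrelevance.

Set Implicit Arguments.
Unset Strict Implicit.
Unset Printing Implicit Defensive.

Declare Scope cat_scope.
Delimit Scope cat_scope with cat.
Local Open Scope cat_scope.

Record category := Category {
  obj :> Type;
  hom : obj -> obj -> Type;
  idm : forall x, hom x x;
  compm : forall x y z, hom y z -> hom x y -> hom x z;
  compm_idl : forall x y (f : hom x y), compm (idm y) f = f;
  compm_idr : forall x y (f : hom x y), compm f (idm x) = f;
  compmA : forall w x y z (h : hom y z) (g : hom x y) (f : hom w x),
    compm h (compm g f) = compm (compm h g) f
}.

Arguments hom {_} _ _.
Arguments idm {_} _.

Notation "g ∘ f" := (compm g f) (at level 40, left associativity) : cat_scope.

Definition is_iso (C : category) (x y : C) (f : hom x y) : Prop :=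
  exists g : hom y x, g ∘ f = idm x /\ f ∘ g = idm y.

Definition isomorphic (C : category) (x y : C) : Prop :=
  exists f : hom x y, is_iso f.

Record functor (C D : category) := Functor {
  fobj :> C -> D;
  fmap : forall x y : C, hom x y -> hom (fobj x) (fobj y);
  fmap_id : forall x : C, fmap (idm x) = idm (fobj x);
  fmap_comp : forall (x y z : C) (g : hom y z) (f : hom x y),
    fmap (g ∘ f) = fmap g ∘ fmap f
}.

Arguments fmap {C D} _ {x y} _.

Record right_adjoint (C D : category) (F : functor C D) := RightAdjoint {
  radj :> functor D C;
  transpose : forall (x : C) (y : D), hom (F x) y -> hom x (radj y);
  untranspose : forall (x : C) (y : D), hom x (radj y) -> hom (F x) y;
  transposeK : forall (x : C) (y : D) (f : hom (F x) y),
    untranspose (transpose f) = f;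
  untransposeK : forall (x : C) (y : D) (g : hom x (radj y)),
    transpose (untranspose g) = g;
  transpose_natural : forall (x' x : C) (y y' : D)
      (a : hom x' x) (f : hom (F x) y) (b : hom y y'),
    transpose (b ∘ f ∘ fmap F a) = fmap radj b ∘ transpose f ∘ a
}.

Record slice_obj (C : category) (B : C) := Slice {
  slice_dom : C;
  slice_arr : hom slice_dom B
}.

Arguments Slice {C B slice_dom} _.

Record slice_hom (C : category) (B : C) (x y : slice_obj B) := SliceHom {
  slice_map : hom (slice_dom x) (slice_dom y);
  slice_tri : slice_arr y ∘ slice_map = slice_arr x
}.

Arguments SliceHom {C B x y} _ _.

Lemma slice_hom_eq (C : category) (B : C) (x y : slice_obj B)
  (f g : slice_hom x y) : slice_map f = slice_map g -> f = g.
Proof.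
case: f g => [f fP] [g gP] /= e; case: g / e gP => gP.
by rewrite (proof_irrelevance _ fP gP).
Qed.

Section SliceCategory.
Variables (C : category) (B : C).

Lemma slice_id_tri (x : slice_obj B) :
  slice_arr x ∘ idm (slice_dom x) = slice_arr x.
Proof. exact: compm_idr. Qed.

Lemma slice_comp_tri (x y z : slice_obj B)
  (g : slice_hom y z) (f : slice_hom x y) :
  slice_arr z ∘ (slice_map g ∘ slice_map f) = slice_arr x.
Proof. by rewrite compmA !slice_tri. Qed.

Definition slice_id (x : slice_obj B) : slice_hom x x :=
  SliceHom (idm (slice_dom x)) (slice_id_tri x).

Definition slice_comp (x y z : slice_obj B)
    (g : slice_hom y z) (f : slice_hom x y) : slice_hom x z :=
  SliceHom (slice_map g ∘ slice_map f) (slice_comp_tri g f).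

Lemma slice_comp_idl x y (f : slice_hom x y) : slice_comp (slice_id y) f = f.
Proof. by apply: slice_hom_eq; apply: compm_idl. Qed.

Lemma slice_comp_idr x y (f : slice_hom x y) : slice_comp f (slice_id x) = f.
Proof. by apply: slice_hom_eq; apply: compm_idr. Qed.

Lemma slice_compA w x y z
  (h : slice_hom y z) (g : slice_hom x y) (f : slice_hom w x) :
  slice_comp h (slice_comp g f) = slice_comp (slice_comp h g) f.
Proof. by apply: slice_hom_eq; apply: compmA. Qed.

Definition slice : category :=
  Category slice_comp_idl slice_comp_idr slice_compA.

End SliceCategory.

Record pullback (C : category) (x y z : C) (f : hom x z) (g : hom y z) :=
  Pullback {
  pb_obj : C;
  pb_fst : hom pb_obj x;
  pb_snd : hom pb_obj y;
  pb_comm : f ∘ pb_fst = g ∘ pb_snd;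
  pb_lift : forall (w : C) (a : hom w x) (b : hom w y),
    f ∘ a = g ∘ b -> hom w pb_obj;
  pb_lift_fst : forall (w : C) (a : hom w x) (b : hom w y)
    (e : f ∘ a = g ∘ b), pb_fst ∘ pb_lift e = a;
  pb_lift_snd : forall (w : C) (a : hom w x) (b : hom w y)
    (e : f ∘ a = g ∘ b), pb_snd ∘ pb_lift e = b;
  pb_ext : forall (w : C) (u v : hom w pb_obj),
    pb_fst ∘ u = pb_fst ∘ v -> pb_snd ∘ u = pb_snd ∘ v -> u = v
}.

(* Chosen pullbacks, so that pulling back along a morphism is a functor. *)
Definition has_pullbacks (C : category) : Type :=
  forall (x y z : C) (f : hom x z) (g : hom y z), pullback f g.

Section PullbackFunctor.
Variables (C : category) (pb : has_pullbacks C) (E B : C) (p : hom E B).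

Definition pullback_fobj (x : slice B) : slice E :=
  Slice (pb_fst (pb p (slice_arr x))).

Lemma pullback_fmap_comm (x y : slice B) (h : hom x y) :
  p ∘ pb_fst (pb p (slice_arr x)) =
  slice_arr y ∘ (slice_map h ∘ pb_snd (pb p (slice_arr x))).
Proof. by rewrite compmA slice_tri pb_comm. Qed.

Definition pullback_fmap (x y : slice B) (h : hom x y) :
    hom (pullback_fobj x) (pullback_fobj y) :=
  @SliceHom C E (pullback_fobj x) (pullback_fobj y)
    (pb_lift (pb p (slice_arr y)) (pullback_fmap_comm h))
    (pb_lift_fst (pb p (slice_arr y)) (pullback_fmap_comm h)).

Lemma pullback_fmap_id (x : slice B) :
  pullback_fmap (idm x) = idm (pullback_fobj x).
Proof.
apply: slice_hom_eq; apply: pb_ext => /=.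
  by rewrite pb_lift_fst compm_idr.
by rewrite pb_lift_snd compm_idr compm_idl.
Qed.

Lemma pullback_fmap_comp (x y z : slice B) (g : hom y z) (f : hom x y) :
  pullback_fmap (g ∘ f) = pullback_fmap g ∘ pullback_fmap f.
Proof.
apply: slice_hom_eq; apply: pb_ext => /=.
  by rewrite compmA !pb_lift_fst.
by rewrite compmA !pb_lift_snd -!compmA pb_lift_snd.
Qed.

Definition pullback_functor : functor (slice B) (slice E) :=
  Functor pullback_fmap_id pullback_fmap_comp.

End PullbackFunctor.

Definition locally_cartesian_closed (C : category) (pb : has_pullbacks C) :
    Type :=
  forall (E B : C) (p : hom E B), right_adjoint (pullback_functor pb p).

Record strict_initial (C : category) := StrictInitial {
  zero :> C;
  from_zero : forall x : C, hom zero x;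
  from_zero_unique : forall (x : C) (f : hom zero x), f = from_zero x;
  zero_strict : forall (x : C) (f : hom x zero), is_iso f
}.

Arguments from_zero {C} _ x.

Section Negation.
Variables (C : category) (pb : has_pullbacks C).
Variables (Pi : locally_cartesian_closed pb) (O : strict_initial C).

(* [slice_dom (neg p)] is B \ im p and [slice_arr (neg p)] its map to B. *)
Definition neg (E B : C) (p : hom E B) : slice B :=
  Pi p (Slice (from_zero O E)).

Definition negneg (A B : C) (f : hom A B) : slice B := neg (slice_arr (neg f)).

Definition closed (A B : C) (f : hom A B) : Prop :=
  @isomorphic (slice B) (negneg f) (Slice f).

Definition dense (A B : C) (f : hom A B) : Prop :=
  @isomorphic (slice B) (negneg f) (Slice (idm B)).

End Negation.

Definition morphism_class (C : category) : Type :=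
  forall x y : C, hom x y -> Prop.

Record orthogonal_factorization_system (C : category)
    (L R : morphism_class C) : Prop := OrthogonalFactorizationSystem {
  ofs_factor : forall (x y : C) (f : hom x y),
    exists (z : C) (l : hom x z) (r : hom z y), L _ _ l /\ R _ _ r /\ f = r ∘ l;
  ofs_unique : forall (x y z z' : C) (l : hom x z) (r : hom z y)
      (l' : hom x z') (r' : hom z' y),
    L _ _ l -> R _ _ r -> L _ _ l' -> R _ _ r' -> r ∘ l = r' ∘ l' ->
    exists! a : hom z z', is_iso a /\ a ∘ l = l' /\ r' ∘ a = r;
  ofs_left_comp : forall (x y z : C) (g : hom y z) (f : hom x y),
    L _ _ g -> L _ _ f -> L _ _ (g ∘ f);
  ofs_right_comp : forall (x y z : C) (g : hom y z) (f : hom x y),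
    R _ _ g -> R _ _ f -> R _ _ (g ∘ f);
  ofs_left_iso : forall (x y : C) (f : hom x y), is_iso f -> L _ _ f;
  ofs_right_iso : forall (x y : C) (f : hom x y), is_iso f -> R _ _ f
}.

(* Main.v *)
(** Call two morphisms into [B] disjoint when every object over both of them is
    empty, i.e. maps to [0]. The adjunction defining [neg p], together with
    strictness of [0], says that [neg p] is the largest subobject of [B] disjoint
    from [p]. So [f] is dense iff only empty objects are disjoint from it, and
    closed iff it is monic and every [x] disjoint from [neg f] factors through
    it. With these descriptions [f] factors as a dense map into [negneg f]
    followed by the closed inclusion, and two (dense, closed) factorizations are
    subobjects each factoring through the other. *)
From Corelib Require Import ssreflect ssrfun.
Require Import Defs.

Set Implicit Arguments.
Unset Strict Implicit.
Unset Printing Implicit Defensive.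
Local Open Scope cat_scope.

Definition mono (C : category) (x y : C) (f : hom x y) : Prop :=
  forall (w : C) (u v : hom w x), f ∘ u = f ∘ v -> u = v.

Definition factors_through (C : category) (x y z : C)
    (f : hom x z) (g : hom y z) : Prop :=
  exists h : hom x y, g ∘ h = f.

Section Monomorphisms.
Variable C : category.

Lemma mono_comp (x y z : C) (g : hom y z) (f : hom x y) :
  mono g -> mono f -> mono (g ∘ f).
Proof. by move=> mg mf w u v; rewrite -!compmA => /mg/mf. Qed.

Lemma iso_mono (x y : C) (f : hom x y) : is_iso f -> mono f.
Proof.
move=> [g [gf _]] w u v e.
by rewrite -(compm_idl u) -(compm_idl v) -gf -!compmA e.
Qed.

Lemma mono_mutual_iso (x y z : C) (f : hom x z) (g : hom y z)
    (a : hom x y) (b : hom y x) :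
  mono f -> mono g -> g ∘ a = f -> f ∘ b = g -> is_iso a.
Proof.
move=> mf mg ga fb; exists b; split.
  by apply: mf; rewrite compmA fb ga compm_idr.
by apply: mg; rewrite compmA ga fb compm_idr.
Qed.

Lemma slice_isomorphic_mono (B : C) (x y : slice B) :
  mono (slice_arr x) -> mono (slice_arr y) ->
  factors_through (slice_arr x) (slice_arr y) ->
  factors_through (slice_arr y) (slice_arr x) -> isomorphic x y.
Proof.
move=> mx my [a ya] [b xb].
exists (SliceHom a ya), (SliceHom b xb).
split; apply: slice_hom_eq.
  by apply: mx; rewrite /= compmA xb ya compm_idr.
by apply: my; rewrite /= compmA ya xb compm_idr.
Qed.

Lemma slice_isomorphic_sym (B : C) (x y : slice B) :
  isomorphic x y -> isomorphic y x.
Proof. by move=> [f [g [gf fg]]]; exists g, f. Qed.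

Lemma slice_isomorphic_factors (B : C) (x y : slice B) :
  isomorphic x y -> factors_through (slice_arr x) (slice_arr y).
Proof. by move=> [f _]; exists (slice_map f); apply: slice_tri. Qed.

(** Lets closed maps inherit monicity from negations. *)
Lemma mono_slice_isomorphic (B : C) (x y : slice B) :
  isomorphic x y -> mono (slice_arr x) -> mono (slice_arr y).
Proof.
move=> [f [g [_ fg]]] mx w u v e.
have eg : slice_map g ∘ u = slice_map g ∘ v.
  by apply: mx; rewrite !compmA !slice_tri.
have {}fg : slice_map f ∘ slice_map g = idm _ := f_equal (@slice_map _ _ _ _) fg.
by rewrite -(compm_idl u) -(compm_idl v) -fg -!compmA eg.
Qed.

End Monomorphisms.

Section Disjointness.
Variables (C : category) (O : strict_initial C).

(** By strictness any map to [O] is invertible, so an empty object is itself initial. *)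
Definition empty (x : C) : Prop := inhabited (hom x O).

Lemma empty_hom_eq (x y : C) (f g : hom x y) : empty x -> f = g.
Proof.
move=> [w]; have [v [vw _]] := zero_strict w.
rewrite -(compm_idr f) -(compm_idr g) -vw !compmA.
by rewrite (from_zero_unique (f ∘ v)) (from_zero_unique (g ∘ v)).
Qed.

Definition disjoint (x y z : C) (f : hom x z) (g : hom y z) : Prop :=
  forall (w : C) (a : hom w x) (b : hom w y), f ∘ a = g ∘ b -> empty w.

Lemma disjoint_sym (x y z : C) (f : hom x z) (g : hom y z) :
  disjoint f g -> disjoint g f.
Proof. by move=> d w a b e; apply: (d w b a). Qed.

Lemma disjoint_comp (w x y z : C) (f : hom x z) (g : hom y z) (a : hom w x) :
  disjoint f g -> disjoint (f ∘ a) g.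
Proof. by move=> d v b c; rewrite -compmA; apply: d. Qed.

(* The image of [f] lies in the double-negation closure of that of [g]: see
   [factors_negnegP]. *)
Definition covered (x y z : C) (f : hom x z) (g : hom y z) : Prop :=
  forall (w : C) (a : hom w x), disjoint (f ∘ a) g -> empty w.

End Disjointness.

Section ClosedDense.
Variables (C : category) (pb : has_pullbacks C).
Variables (Pi : locally_cartesian_closed pb) (O : strict_initial C).

(** The counit, obtained by untransposing the identity, maps the pullback of [neg p] along [p] to
    [O]; every object over both maps into that pullback. *)
Lemma neg_disjoint (E B : C) (p : hom E B) :
  disjoint O (slice_arr (neg Pi O p)) p.
Proof.
move=> w a b e.
have t := untranspose (r := Pi p) (idm (neg Pi O p)).
have e' : p ∘ b = slice_arr (neg Pi O p) ∘ a by [].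
split; exact: (slice_map t ∘ pb_lift (pb p _) e').
Qed.

(** Disjointness at the pullback of [f] along [p] makes it empty, so it maps to [from_zero O E] over
    [E]; the transpose of this map is the factorization. *)
Lemma neg_factors (E B : C) (p : hom E B) (x : C) (f : hom x B) :
  disjoint O f p -> factors_through f (slice_arr (neg Pi O p)).
Proof.
move=> d.
have em : empty O (pb_obj (pb p f)).
  by apply: d; apply: esym; apply: pb_comm.
have [w] := em.
have tri : from_zero O E ∘ w = pb_fst (pb p f) by apply: empty_hom_eq em.
pose h : hom (pullback_functor pb p (Slice f)) (Slice (from_zero O E)) :=
  @SliceHom C E (pullback_fobj pb p (Slice f)) (Slice (from_zero O E)) w tri.
pose k := transpose (Pi p) h.
by exists (slice_map k); apply: (slice_tri k).
Qed.

(* Transposing turns parallel maps into [neg p] into parallel maps into [0],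
   which agree by strictness. *)
Lemma neg_mono (E B : C) (p : hom E B) : mono (slice_arr (neg Pi O p)).
Proof.
move=> w u v e.
pose x : slice B := Slice (slice_arr (neg Pi O p) ∘ v).
pose hu : hom x (neg Pi O p) := @SliceHom C B x (neg Pi O p) u e.
pose hv : hom x (neg Pi O p) := @SliceHom C B x (neg Pi O p) v erefl.
suff : hu = hv by move=> /(f_equal (@slice_map _ _ _ _)).
rewrite -(untransposeK (r := Pi p) hu) -(untransposeK (r := Pi p) hv).
congr (transpose _ _); apply: slice_hom_eq; apply: empty_hom_eq.
by split; apply: slice_map (untranspose (r := Pi p) hu).
Qed.

Lemma disjoint_negP (x A B : C) (g : hom x B) (f : hom A B) :
  disjoint O g (slice_arr (neg Pi O f)) <-> covered O g f.
Proof.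
split=> [d w a /neg_factors [b e]|c w a b e]; first by apply: d (esym e).
apply: (c w a); rewrite e.
by apply: disjoint_comp; apply: neg_disjoint.
Qed.

Lemma factors_negnegP (x A B : C) (g : hom x B) (f : hom A B) :
  factors_through g (slice_arr (negneg Pi O f)) <-> covered O g f.
Proof.
split=> [[h <-]|c]; last by apply: neg_factors; apply/disjoint_negP.
by apply/disjoint_negP; apply: disjoint_comp; apply: neg_disjoint.
Qed.

Lemma covered_refl (A B : C) (f : hom A B) : covered O f f.
Proof.
by apply/disjoint_negP; apply: disjoint_sym; apply: neg_disjoint.
Qed.

Lemma closedP (A B : C) (f : hom A B) :
  closed Pi O f <->
  mono f /\ (forall (x : C) (g : hom x B), covered O g f -> factors_through g f).
Proof.
split=> [cl|[mf cl]].
  split=> [|x g /factors_negnegP [h <-]].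
    exact: (mono_slice_isomorphic cl (@neg_mono _ _ _)).
  have [k e] := slice_isomorphic_factors cl.
  by exists (k ∘ h); rewrite compmA e.
apply: slice_isomorphic_mono => //; first exact: neg_mono.
  by apply: cl; apply/factors_negnegP; exists (idm _); apply: compm_idr.
by apply/factors_negnegP; apply: covered_refl.
Qed.

Lemma denseP (A B : C) (f : hom A B) :
  dense Pi O f <->
  (forall (w : C) (b : hom w B), disjoint O b f -> empty O w).
Proof.
have idP : covered O (idm B) f <->
    (forall (w : C) (b : hom w B), disjoint O b f -> empty O w).
  by split=> c w b; have := c w b; rewrite compm_idl.
split=> [d|/idP/factors_negnegP fac].
  apply/idP; apply/factors_negnegP.
  exact: slice_isomorphic_factors (slice_isomorphic_sym d).
apply: slice_isomorphic_mono => //; first exact: neg_mono.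
  by apply: iso_mono; exists (idm B); rewrite compm_idl.
by exists (slice_arr (negneg Pi O f)); apply: compm_idl.
Qed.

(** A triple negation argument: whatever lies over [neg f] is disjoint from [negneg f], so a map
    covered by [negneg f] is disjoint from [neg f]. *)
Lemma closed_negneg (A B : C) (f : hom A B) :
  closed Pi O (slice_arr (negneg Pi O f)).
Proof.
apply/closedP; split=> [|x g c]; first exact: neg_mono.
apply: neg_factors => w a b e; apply: (c w a); rewrite e.
by apply: disjoint_comp; apply: disjoint_sym; apply: neg_disjoint.
Qed.

(** Since [negneg f] is monic, disjointness from [l] becomes disjointness from [f] in [B], and
    [negneg f] is covered by [f]. *)
Lemma dense_negneg (A B : C) (f : hom A B) (l : hom A (slice_dom (negneg Pi O f))) :
  slice_arr (negneg Pi O f) ∘ l = f -> dense Pi O l.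
Proof.
move=> e; apply/denseP => w b d.
have c : covered O (slice_arr (negneg Pi O f)) f.
  by apply/factors_negnegP; exists (idm _); apply: compm_idr.
apply: (c w b) => v s t e'; apply: (d v s t); apply: (neg_mono).
by rewrite !compmA e.
Qed.

Lemma dense_comp (x y z : C) (g : hom y z) (f : hom x y) :
  dense Pi O g -> dense Pi O f -> dense Pi O (g ∘ f).
Proof.
move=> /denseP dg /denseP df; apply/denseP => w b d.
(* An object [v] over both [b] and [g] gives [t] disjoint from [f], hence is empty; so [b] is
   disjoint from [g]. *)
apply: (dg w b) => v s t e; apply: (df v t) => u i j e'.
by apply: (d u (s ∘ i) j); rewrite compmA e -!compmA e'.
Qed.

(** A map covered by [g ∘ f] is covered by [g], hence factors through it; cancelling the monic [g]
    shows that the factor is covered by [f]. *)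
Lemma closed_comp (x y z : C) (g : hom y z) (f : hom x y) :
  closed Pi O g -> closed Pi O f -> closed Pi O (g ∘ f).
Proof.
move=> /closedP [mg cg] /closedP [mf cf]; apply/closedP.
split=> [|w h c]; first exact: mono_comp.
have [k e] : factors_through h g.
  apply: cg => v a d; apply: (c v a) => u i j; rewrite -(compmA g); exact: d.
have [m e'] : factors_through k f.
  apply: cf => v a d; apply: (c v a) => u i j; rewrite -e -!compmA => /mg.
  by rewrite compmA; apply: d.
by exists m; rewrite -compmA e' e.
Qed.

Lemma dense_iso (x y : C) (f : hom x y) : is_iso f -> dense Pi O f.
Proof.
move=> [g [_ fg]]; apply/denseP => w b d.
by apply: (d w (idm w) (g ∘ b)); rewrite compmA fg compm_idl compm_idr.
Qed.

Lemma closed_iso (x y : C) (f : hom x y) : is_iso f -> closed Pi O f.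
Proof.
move=> isof; apply/closedP; split=> [|w h _]; first exact: iso_mono.
by have [g [_ fg]] := isof; exists (g ∘ h); rewrite compmA fg compm_idl.
Qed.

(** The map [r] is covered by [r']: an object over both [a] and [l] lies, via [l'], over both
    [r ∘ a] and [r'], so disjointness of the latter pair passes to the former and density
    applies. *)
Lemma dense_closed_lift (x y z z' : C) (l : hom x z) (r : hom z y)
    (l' : hom x z') (r' : hom z' y) :
  dense Pi O l -> closed Pi O r' -> r ∘ l = r' ∘ l' -> factors_through r r'.
Proof.
move=> /denseP dl /closedP [_ cr'] e; apply: cr' => w a d.
apply: (dl w a) => v s t e'.
by apply: (d v s (l' ∘ t)); rewrite -compmA e' !compmA e.
Qed.

End ClosedDense.

Theorem theorem3p3p9 (C : category) (pb : has_pullbacks C)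
    (Pi : locally_cartesian_closed pb) (O : strict_initial C) :
  orthogonal_factorization_system (dense Pi O) (closed Pi O).
Proof.
split.
- move=> x y f.
  have [l e] : factors_through f (slice_arr (negneg Pi O f)).
    by apply/factors_negnegP; apply: covered_refl.
  exists (slice_dom (negneg Pi O f)), l, (slice_arr (negneg Pi O f)).
  split; first exact: dense_negneg e.
  by split; first exact: closed_negneg.
- move=> x y z z' l r l' r' dl cr dl' cr' e.
  have [a ra] := dense_closed_lift dl cr' e.
  have [b rb] := dense_closed_lift dl' cr (esym e).
  have [[mr _] [mr' _]] := (proj1 (closedP _ _ _) cr, proj1 (closedP _ _ _) cr').
  (* Cancelling the monic [r'] gives uniqueness from [r' ∘ a = r] alone, and below also
     [a ∘ l = l']. *)
  exists a; split; last by move=> c [_ [_ rc]]; apply: mr'; rewrite ra rc.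
  split; first exact: mono_mutual_iso mr mr' ra rb.
  by split; first by apply: mr'; rewrite compmA ra.
- exact: dense_comp.
- exact: closed_comp.
- exact: dense_iso.
- exact: closed_iso.
Qed.
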